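(* Let $G=(V,E)$ be a connected finite graph with vertex measure $\mu$ and symmetric edge weights $\omega$. Let $N$ and $n_1,\dots,n_N$ be positive integers, let $\theta,e,g$ be real constants with $e\neq0$ and $g\neq 0$, and let $p_{i,s}$ ($i=1,\dots,N$, $s=1,\dots,n_i$) be vertices of $G$. Put $n=\sum_{i=1}^N n_i$ and $$a_{ij}=\frac1N\left(\frac{e^2}{2}-\frac{g^2}{2N}\right)+\delta_{ij}\frac{g^2}{2N},\qquad i,j=1,\dots,N,$$ where $\delta_{ij}$ is the Kronecker delta. Then the system of equations on $V$ $$\Delta u_i(x)=\sum_{j=1}^N a_{ij}\left(\exp(u_j(x))-\theta^2\right)+4\pi\sum_{s=1}^{n_i}\delta_{p_{i,s}}(x),\qquad i=1,\dots,N,$$ for unknown functions $u_1,\dots,u_N:V\to\mathbb{R}$ admits a unique solution $(u_1,\dots,u_N)$ if and only if $$n_i<\frac{g^2\theta^2}{8\pi N}|V|+\frac1N\left(1-\frac1N\left(\frac{g}{e}\right)^2\right)n,\qquad i=1,\dots,N.$$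
   Context: $G=(V,E)$ is a connected finite graph with vertex set $V$ and edge set $E$; $y\sim x$ means $xy\in E$. $\mu:V\to(0,+\infty)$ is a finite measure on the vertices and $|V|=\mathrm{Vol}(V)=\sum_{x\in V}\mu(x)$ is the volume of $V$ (not its cardinality). $\omega:V\times V\to[0,\infty)$ is an edge weight function with $\omega_{xy}=\omega_{yx}$ for all $x,y\in V$ and $\omega_{xy}>0$ if and only if $x\sim y$. For $u:V\to\mathbb{R}$, the Laplacian is $$\Delta u(x)=\frac{1}{\mu(x)}\sum_{y\sim x}\omega_{yx}\,(u(y)-u(x)).$$ Integrals are $\int_V u\,d\mu=\sum_{x\in V}\mu(x)u(x)$. $\delta_p$ is the Dirac mass at the vertex $p$ with respect to $\mu$: $\delta_p(x)=1/\mu(p)$ if $x=p$ and $\delta_p(x)=0$ otherwise, so that $\int_V\delta_p\,d\mu=1$. The letter $e$ denotes a real constant (a coupling parameter), not the base of the natural logarithm; $\exp$ is the exponential function. A solution is a tuple of real-valued functions on $V$ satisfying the equations at every vertex. *)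

(* Defs.v *)
From HB Require Import structures.
From mathcomp Require Import all_boot all_order all_algebra.
From mathcomp Require Import boolp reals sequences exp trigo.
Set Implicit Arguments.
Unset Strict Implicit.
Unset Printing Implicit Defensive.
Import Order.TTheory GRing.Theory Num.Theory.

Local Open Scope ring_scope.

Definition connected_graph (V : finType) (adj : rel V) : Prop :=
  forall x y : V, connect adj x y.

Definition edge_weight (R : realType) (V : finType) (adj : rel V)
    (w : V -> V -> R) : Prop :=
  [/\ forall x y : V, 0 <= w x y,
      forall x y : V, w x y = w y x
    & forall x y : V, (0 < w x y) <-> adj x y].

(* The volume is taken with respect to mu; it is not the number of vertices. *)
Definition volume (R : realType) (V : finType) (mu : V -> R) : R :=
  \sum_(x : V) mu x.

Definition laplacian (R : realType) (V : finType) (adj : rel V) (mu : V -> R)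
    (w : V -> V -> R) (u : V -> R) (x : V) : R :=
  (mu x)^-1 * \sum_(y : V | adj x y) w y x * (u y - u x).

(* Density of the Dirac mass at p with respect to mu: it integrates to 1
   against mu. *)
Definition vertex_dirac (R : realType) (V : finType) (mu : V -> R)
    (p x : V) : R :=
  if x == p then (mu p)^-1 else 0.

(* The real e is the coupling parameter, not the base of the logarithm. *)
Definition coupling (R : realType) (N : nat) (e g : R) (i j : 'I_N) : R :=
  N%:R^-1 * (e ^+ 2 / 2 - g ^+ 2 / (2 * N%:R))
  + (i == j)%:R * (g ^+ 2 / (2 * N%:R)).

Definition vortex_solution (R : realType) (V : finType) (adj : rel V)
    (mu : V -> R) (w : V -> V -> R) (N : nat) (n : 'I_N -> nat)
    (theta e g : R) (p : forall i : 'I_N, 'I_(n i) -> V)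
    (u : 'I_N -> V -> R) : Prop :=
  forall (i : 'I_N) (x : V),
    laplacian adj mu w (u i) x =
      \sum_(j < N) coupling e g i j * (expR (u j x) - theta ^+ 2)
      + 4 * pi * \sum_(s < n i) vertex_dirac mu (p i s) x.

(* Main.v *)
Require Import Defs.
From HB Require Import structures.
From mathcomp Require Import all_boot all_order all_algebra.
From mathcomp Require Import ring lra.
From mathcomp Require Import boolp classical_sets reals topology normedtype.
From mathcomp Require Import derive sequences exp trigo.
Set Implicit Arguments.
Unset Strict Implicit.
Unset Printing Implicit Defensive.
Import Order.TTheory GRing.Theory Num.Theory.
Import numFieldNormedType.Exports.

Local Open Scope ring_scope.

(** The matrix A = (a_ij) has the form a J + c I, where J is the all-ones
matrix, with eigenvalue g^2/(2N) on vectors of zero sum and e^2/2 on constants;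
so it is positive definite.  Multiplying the system by B = A^-1, and the
equation at x by mu(x), gives

    sum_l Q_kl u_l + m_k exp(u_k) = b_k,   k = (i, x),  m_(i,x) = mu(x),

where Q is the tensor product of B with the graph Laplacian matrix
[vortex_solutionP].  This is the Euler-Lagrange equation of

    F(u) = (1/2) <u, Q u> + sum_k m_k exp(u_k) - sum_k b_k u_k.

The matrix Q is symmetric and positive semidefinite, because <z, Q z> is half of
the sum over ordered pairs (x, y) of w_xy times the B-form of the vector
z(., x) - z(., y).  Since the graph is connected, the kernel of Q consists of the
families of constants z(i, x) = c_i.

Uniqueness [energy_critical_unique]: pairing the difference of two solutions with
itself gives a sum of nonnegative terms equal to 0, and exp is strictly
increasing.

Necessity: the rows of Q sum to 0 over x, so the integral of exp(u_i) must equal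
the flux h_i, the sum of b_(i,x) over x.  Hence h_i > 0, and up to a positive
factor this is the stated inequality [vortex_flux_gt0].

Sufficiency: F grows at least quadratically along every direction z outside the
kernel of Q or with some positive entry.  The remaining directions are families
of constants c_i <= 0, along which <b, z>, the sum of the h_i c_i, is negative, so
F still grows linearly.  A compactness argument on directions makes this uniform
[energy_uniform_growth], so that F attains its minimum over some box
in the interior; its partial derivatives vanish there [energy_critical_point]. *)

(** * Elementary inequalities *)

Lemma expR_ge_pos_sqr (R : realType) (s : R) :
  2^-1 * Num.max s 0 ^+ 2 <= expR s.
Proof.
case: (leP s 0) => s0; first by rewrite expr0n mulr0 expR_ge0.
have := expR_ge1Dxn 1 (ltW s0); rewrite (_ : 2`! = 2)%N// mulrC; lra.
Qed.

(** Obtained from 1 - t <= exp(-t), which bounds exp t by 1 / (1 - t); the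
threshold 1/2 is where 1 + t + 2 t^2 stops dominating that fraction. *)
Lemma expR_le_quadratic (R : realType) (t : R) :
  t <= 2^-1 -> expR t <= 1 + t + 2 * t ^+ 2.
Proof.
move=> t2; have := expR_ge1Dx (- t); rewrite expRN => h.
have et := expR_gt0 t.
have h2 : expR t * (1 - t) <= 1.
  by rewrite -ler_pdivlMl// mulr1.
have : 1 <= (1 + t + 2 * t ^+ 2) * (1 - t) by have := sqr_ge0 t; nra.
have : 0 < 1 - t by lra.
move=> t1 h3; rewrite -(ler_pM2r t1); lra.
Qed.

(** Fermat's rule for an interior minimum, in the form that follows an upper
quadratic estimate. *)
Lemma quadratic_ge0_slope (R : realType) (L C d : R) : 0 < d ->
  (forall t : R, `|t| < d -> 0 <= t * L + t ^+ 2 * C) -> L = 0.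
Proof.
move=> d0 H; apply/eqP/contraT => L0.
pose c := `|C| + 1; have c0 : 0 < c by rewrite /c; have := normr_ge0 C; lra.
have Cc : C < c by have := ler_norm C; rewrite /c; lra.
pose s := Num.min (d / 2) (`|L| / c).
have nL : 0 < `|L| by rewrite normr_gt0.
have s0 : 0 < s by rewrite lt_min !divr_gt0.
have sd : s < d.
  have : s <= d / 2 by rewrite ge_min lexx. lra.
have sL : s * c <= `|L| by rewrite -ler_pdivlMr// ge_min lexx orbT.
(* Stepping against the sign of L makes the linear term win over t ^+ 2 * C. *)
have := H (- Num.sg L * s); rewrite normrM normrN normr_sg L0 mul1r (gtr0_norm s0) => /(_ sd).
rewrite exprMn sqrrN sqr_sg L0 mul1r.
have -> : - Num.sg L * s * L = - (s * `|L|).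
  by rewrite [in RHS](normrEsg L); ring.
move=> h.
have : s * (s * C) < s * `|L|.
  by rewrite ltr_pM2l//; apply: lt_le_trans sL; rewrite ltr_pM2l.
by move=> h2; exfalso; nra.
Qed.

(** * Quadratic plus exponential energies on a finite index set *)

Definition bilin (R : realType) (K : finType) (Q : K -> K -> R) (u v : K -> R) : R :=
  \sum_k \sum_l Q k l * (u k * v l).

Definition energy (R : realType) (K : finType) (Q : K -> K -> R) (m b u : K -> R) : R :=
  2^-1 * bilin Q u u + \sum_k m k * expR (u k) - \sum_k b k * u k.

Section Continuity.
Context {R : realType}.

Lemma mul_continuous (X : topologicalType) (f h : X -> R) :
  continuous f -> continuous h -> continuous (fun z => f z * h z).
Proof. by move=> cf ch z; exact: continuousM (cf z) (ch z). Qed.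

Lemma plus_continuous (X : topologicalType) (f h : X -> R) :
  continuous f -> continuous h -> continuous (fun z => f z + h z).
Proof. by move=> cf ch z; exact: continuousD (cf z) (ch z). Qed.

Lemma scale_continuous (X : topologicalType) (c : R) (f : X -> R) :
  continuous f -> continuous (fun z => c * f z).
Proof.
move=> cf; apply: (@mul_continuous X (fun=> c) f) => // z.
exact: cst_continuous.
Qed.

Lemma sum_continuous (X : topologicalType) (I : finType) (f : I -> X -> R) :
  (forall i, continuous (f i)) -> continuous (fun z => \sum_i f i z).
Proof.
move=> cf z; elim: (index_enum I) => [|i r IH].
  by under eq_fun do rewrite big_nil; exact: cst_continuous.
by under eq_fun do rewrite big_cons; apply: continuousD; [exact: cf|].
Qed.

Context {K : finType}.
Local Notation T := {ptws K -> R}.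

Lemma eval_continuous (k : K) : continuous (fun z : T => z k).
Proof. exact: (@proj_continuous K (fun _ => R) k). Qed.

Lemma bilin_continuous (Q : K -> K -> R) : continuous (fun z : T => bilin Q z z).
Proof.
apply: sum_continuous => k; apply: sum_continuous => l.
by apply/scale_continuous/mul_continuous; exact: eval_continuous.
Qed.

Lemma linear_continuous (b : K -> R) :
  continuous (fun z : T => \sum_k b k * z k).
Proof. by apply: sum_continuous => k; exact/scale_continuous/eval_continuous. Qed.

Lemma energy_continuous (Q : K -> K -> R) (m b : K -> R) :
  continuous (fun z : T => energy Q m b z).
Proof.
apply: plus_continuous; last first.
  by move=> z; exact/continuousN/linear_continuous.
apply: plus_continuous; first exact/scale_continuous/bilin_continuous.
apply: sum_continuous => k; apply: scale_continuous => z.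
exact: (continuous_comp (@eval_continuous k z) (@continuous_expR R _)).
Qed.

(** This is the quadratic growth rate of the energy in the direction z; squaring
the positive part minorises the exponential by a continuous function that is
homogeneous of degree 2. *)
Definition growth (Q : K -> K -> R) (m z : K -> R) : R :=
  2^-1 * bilin Q z z + \sum_k m k * (2^-1 * Num.max (z k) 0 ^+ 2).

Lemma growth_continuous (Q : K -> K -> R) (m : K -> R) :
  continuous (fun z : T => growth Q m z).
Proof.
apply: plus_continuous; first exact/scale_continuous/bilin_continuous.
apply: sum_continuous => k; do 2 apply: scale_continuous.
have cm : continuous (fun z : T => Num.max (z k) 0).
  by move=> z; apply: continuous_max; [exact: eval_continuous|exact: cst_continuous].
exact: mul_continuous.
Qed.

End Continuity.

(** * Existence and uniqueness of critical points *)

Section Minimisation.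
Context {R : realType} {K : finType}.
Variables (Q : K -> K -> R) (m b : K -> R).
Hypothesis Q_psd : forall z, 0 <= bilin Q z z.
Hypothesis m_gt0 : forall k, 0 < m k.
(* The quadratic and exponential terms stay bounded exactly along the directions
   of the kernel of Q with no positive entry; the linear term must grow there. *)
Hypothesis recession : forall z : K -> R, bilin Q z z = 0 -> (forall k, z k <= 0) ->
  (exists k, z k != 0) -> \sum_k b k * z k < 0.
Local Notation T := ({ptws K -> R}).

Lemma growth_term_ge0 (z : K -> R) k : 0 <= m k * (2^-1 * Num.max (z k) 0 ^+ 2).
Proof.
apply: mulr_ge0; first exact: ltW.
by apply: mulr_ge0; [rewrite invr_ge0|exact: sqr_ge0].
Qed.

Lemma growth_ge0 z : 0 <= growth Q m z.
Proof.
apply: addr_ge0; first by rewrite mulr_ge0 ?invr_ge0.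
by apply: sumr_ge0 => k _; exact: growth_term_ge0.
Qed.

Lemma growth_eq0 z : growth Q m z = 0 ->
  bilin Q z z = 0 /\ forall k, z k <= 0.
Proof.
move/eqP; rewrite paddr_eq0; last 2 first.
- by rewrite mulr_ge0 ?invr_ge0.
- by apply: sumr_ge0 => k _; exact: growth_term_ge0.
case/andP; rewrite mulf_eq0 invr_eq0 pnatr_eq0 /= => /eqP ->.
rewrite psumr_eq0; last by move=> k _; exact: growth_term_ge0.
move=> /allP h; split=> // k; have := h k (mem_index_enum _).
rewrite /= !mulf_eq0 (gt_eqF (m_gt0 k)) invr_eq0 pnatr_eq0 orbb /= => /eqP h0.
by move: (le_max (z k) (z k) 0); rewrite lexx /= h0.
Qed.

Lemma energy_scale_ge z (t : R) : 0 <= t ->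
  t * (t * growth Q m z - \sum_k b k * z k) <= energy Q m b (fun k => t * z k).
Proof.
move=> t0; rewrite /energy /growth.
have -> : bilin Q (fun k => t * z k) (fun k => t * z k) = t ^+ 2 * bilin Q z z.
  rewrite /bilin mulr_sumr; apply: eq_bigr => k _; rewrite mulr_sumr.
  by apply: eq_bigr => l _; ring.
have -> : \sum_k b k * (t * z k) = t * \sum_k b k * z k.
  by rewrite mulr_sumr; apply: eq_bigr => k _; ring.
have : t ^+ 2 * \sum_k m k * (2^-1 * Num.max (z k) 0 ^+ 2)
       <= \sum_k m k * expR (t * z k).
  rewrite mulr_sumr; apply: ler_sum => k _.
  rewrite mulrCA ler_pM2l//; apply: le_trans (expR_ge_pos_sqr _).
  have -> : Num.max (t * z k) 0 = t * Num.max (z k) 0 by rewrite maxr_pMr// mulr0.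
  lra.
nra.
Qed.

(** Along each direction z the lower bound n (n G(z) - <b, z>) of
[energy_scale_ge], where G(z) is the growth rate, tends to infinity with n: either
G(z) > 0, or G(z) = 0 and the recession hypothesis gives <b, z> < 0.  Both strict
inequalities persist near z, so compactness of the set of directions yields one n
for all of them.  Directions are normalised by sup norm at most 1 and l1 norm at
least 1 because this closed set contains every vector of sup norm 1. *)
Lemma energy_uniform_growth (M : R) : exists2 r : R, 0 < r &
  forall z : K -> R, (forall k, `|z k| <= 1) -> 1 <= \sum_k `|z k| ->
  M < energy Q m b (fun k => r * z k).
Proof.
pose S : set T := ([set z : T | forall k, `[-1, 1] (z k)] `&`
   [set z : T | (1 <= \sum_k `|z k|)%R])%classic.
have cS : compact S.
  apply: compact_closedI.
    by apply: (@tychonoff K (fun _ => R) (fun _ => `[-1, 1]%classic)) => _;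
      exact: segment_compact.
  have cn : continuous (fun z : T => \sum_k `|z k|).
    apply: sum_continuous => k z.
    exact: (continuous_comp (@eval_continuous _ _ k z) (@norm_continuous _ R _)).
  by move/continuous_closedP: cn => /(_ _ (@closed_ge R 1)).
have /compact_near_coveringP cov := cS.
have : (\forall n \near \oo, S `<=`
   (fun z : T => (0 < n)%N /\ M < n%:R * (n%:R * growth Q m z - \sum_k b k * z k)))%classic.
  apply: cov => z [zb zS].
  have zn : exists k, z k != 0.
    apply: contrapT => /forallNP z0.
    have sum0 : \sum_k `|z k| = 0.
      by apply: big1 => k _; have /negP/negbNE/eqP -> := z0 k; rewrite normr0.
    by move: zS; rewrite /= sum0 ler10.
  have [G0|G0] := eqVneq (growth Q m z) 0.
    have [q0 zle] := growth_eq0 G0.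
    have bz := recession q0 zle zn.
    pose eta := - (\sum_k b k * z k) / 2.
    have eta0 : 0 < eta by rewrite /eta; lra.
    near=> z' n => /=.
    have h1 : \sum_k b k * z' k < - eta.
      near: z'; apply: cvgr_lt; first exact: linear_continuous.
      rewrite /eta; lra.
    have n0 : (0 < n)%N by near: n; exists 1%N.
    have h2 : M / eta < n%:R by near: n; exact: nbhs_infty_gtr.
    split=> //; move: h2; rewrite ltr_pdivrMr//.
    have := growth_ge0 z'; have : 0 < n%:R :> R by rewrite ltr0n.
    move: (growth Q m z') (\sum_k b k * z' k) (n%:R : R) h1 => G B t h1 t0 G0' h2.
    apply: (lt_le_trans h2); rewrite ler_pM2l//.
    have : 0 <= t * G by rewrite mulr_ge0// ltW.
    lra.
  have Gp : 0 < growth Q m z by rewrite lt_neqAle eq_sym G0 growth_ge0.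
  pose gam := growth Q m z / 2; have gam0 : 0 < gam by rewrite /gam; lra.
  pose be := \sum_k b k * z k + 1.
  near=> z' n => /=.
  have h1 : \sum_k b k * z' k < be.
    near: z'; apply: cvgr_lt; first exact: linear_continuous.
    rewrite /be; lra.
  have h3 : gam < growth Q m z'.
    near: z'; apply: cvgr_gt; first exact: growth_continuous.
    rewrite /gam; lra.
  have n0 : (0 < n)%N by near: n; exists 1%N.
  have h2 : M < n%:R by near: n; exact: nbhs_infty_gtr.
  have h4 : (be + 1) / gam < n%:R by near: n; exact: nbhs_infty_gtr.
  split=> //; move: h4; rewrite ltr_pdivrMr//.
  have : 0 < n%:R :> R by rewrite ltr0n.
  move: (growth Q m z') (\sum_k b k * z' k) (n%:R : R) h1 h3 h2 => G B t h1 h3 h2 t0 h4.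
  apply: (lt_trans h2); rewrite -[X in X < _]mulr1 ltr_pM2l//.
  have : t * gam < t * G by rewrite ltr_pM2l.
  lra.
move=> [n _ H]; exists n.+1%:R; first by rewrite ltr0n.
move=> z zb z1; have [|_ Mlt] := H n.+1 (leqnSn n) z.
  by split=> // k; rewrite /= in_itv /= -ler_norml.
by apply: (lt_le_trans Mlt); apply: energy_scale_ge.
Unshelve. all: by end_near. Qed.

(** By continuity the energy has a minimiser on the box of radius r; a minimiser
on the boundary would have larger energy than the origin, by the choice of r. *)
Lemma energy_minimizer : exists r : R, exists2 u : K -> R,
  (forall k, `|u k| < r) &
  forall v : K -> R, (forall k, `|v k| <= r) -> energy Q m b u <= energy Q m b v.
Proof.
have [r r0 far] := energy_uniform_growth (energy Q m b (fun=> 0)).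
pose A : set T := [set z : T | forall k, `[- r, r]%classic (z k)]%classic.
have inA v : (forall k, `|v k| <= r) -> A v.
  by move=> vr k; rewrite /= in_itv /= -ler_norml.
have cA : compact A.
  by apply: (@tychonoff K (fun _ => R) (fun _ => `[- r, r]%classic)) => _;
    exact: segment_compact.
have A0 : (A !=set0)%classic by exists (fun=> 0); apply: inA => k; rewrite normr0 ltW.
have cE := continuous_subspaceT (@energy_continuous R K Q m b).
have [u + umin] := compact_EVT_min A0 cA (cE A).
rewrite inE => Au.
have ur k : `|u k| <= r by have := Au k; rewrite /= in_itv /= ler_norml.
have {}umin v : (forall k, `|v k| <= r) -> energy Q m b u <= energy Q m b v.
  by move=> vr; apply: umin; rewrite inE; exact: inA.
exists r, u => // k; rewrite lt_neqAle ur andbT; apply/negP => /eqP uk.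
have := umin (fun=> 0); rewrite normr0 => /(_ (fun=> ltW r0)).
have -> : energy Q m b u = energy Q m b (fun k => r * (u k / r)).
  by congr energy; apply/funext => l; rewrite mulrCA divff ?mulr1 ?gt_eqF.
have zE l : `|u l / r| = `|u l| / r by rewrite normrM normfV (gtr0_norm r0).
rewrite leNgt far// => [l|]; first by rewrite zE ler_pdivrMr// mul1r.
rewrite (bigD1 k)//= zE uk divff ?gt_eqF// lerDl.
by apply: sumr_ge0 => l _; exact: normr_ge0.
Qed.

Hypothesis Q_sym : forall k l, Q k l = Q l k.

Lemma bilinC u v : bilin Q u v = bilin Q v u.
Proof.
rewrite /bilin exchange_big /=; apply: eq_bigr => k _; apply: eq_bigr => l _.
by rewrite Q_sym (mulrC (u l)).
Qed.

Lemma bilin_line u d (t : R) :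
  bilin Q (fun k => u k + t * d k) (fun k => u k + t * d k) =
  bilin Q u u + 2 * t * bilin Q d u + t ^+ 2 * bilin Q d d.
Proof.
have -> : 2 * t * bilin Q d u = t * bilin Q u d + t * bilin Q d u.
  by rewrite (bilinC u); ring.
rewrite /bilin !mulr_sumr -!big_split /=; apply: eq_bigr => k _.
rewrite !mulr_sumr -!big_split /=; apply: eq_bigr => l _; ring.
Qed.

(** A quadratic upper bound on the increments suffices for the first-order
condition, and avoids differentiating the energy. *)
Lemma energy_coord_le u k (t : R) : t <= 2^-1 ->
  energy Q m b (fun l => u l + t * (l == k)%:R) <= energy Q m b u +
    (t * (\sum_l Q k l * u l + m k * expR (u k) - b k)
     + t ^+ 2 * (2^-1 * Q k k + 2 * (m k * expR (u k)))).
Proof.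
move=> t2; rewrite /energy (bilin_line u (fun l => (l == k)%:R)).
have pick (f : K -> R) : \sum_l f l * (l == k)%:R = f k.
  rewrite (bigD1 k)//= eqxx mulr1 big1 ?addr0// => l /negPf ->.
  by rewrite mulr0.
have delta v : bilin Q (fun l => (l == k)%:R) v = \sum_l Q k l * v l.
  rewrite /bilin -[RHS](pick (fun k => \sum_l Q k l * v l)); apply: eq_bigr => l _.
  by rewrite mulr_suml; apply: eq_bigr => j _; ring.
rewrite !delta pick.
have -> : \sum_l b l * (u l + t * (l == k)%:R) = \sum_l b l * u l + t * b k.
  rewrite -(pick b) mulr_sumr -big_split /=; apply: eq_bigr => l _; ring.
have : \sum_l m l * expR (u l + t * (l == k)%:R) <=
       \sum_l m l * expR (u l) + m k * expR (u k) * (t + 2 * t ^+ 2).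
  rewrite -(pick (fun k => m k * expR (u k) * _)) -big_split /=.
  apply: ler_sum => l _; case: eqVneq => [->|_]; last by rewrite !mulr0 !addr0.
  rewrite !mulr1 expRD; have h := expR_le_quadratic t2.
  have : 0 < m k * expR (u k) by rewrite mulr_gt0 ?expR_gt0.
  by move=> p0; rewrite -(ler_pM2l p0) in h; lra.
lra.
Qed.

Theorem energy_critical_point :
  exists u : K -> R, forall k, \sum_l Q k l * u l + m k * expR (u k) = b k.
Proof.
have [r [u ur umin]] := energy_minimizer; exists u => k.
apply/eqP; rewrite -subr_eq0; apply/eqP.
apply: (@quadratic_ge0_slope _ _ (2^-1 * Q k k + 2 * (m k * expR (u k)))
          (Num.min 2^-1 (r - `|u k|))).
  by rewrite lt_min invr_gt0 ltr0n subr_gt0 ur.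
move=> t; rewrite lt_min => /andP[t2 tr].
have t2' : t <= 2^-1 by apply: ltW; apply: le_lt_trans t2; exact: ler_norm.
pose v l := u l + t * (l == k)%:R.
have := energy_coord_le u k t2'; rewrite -/v.
suff : energy Q m b u <= energy Q m b v by lra.
apply: umin; rewrite /v => l; case: eqVneq => [->|_]; last by rewrite mulr0 addr0 ltW.
by rewrite mulr1; apply: (le_trans (ler_normD _ _)); lra.
Qed.

End Minimisation.

(** The equation is the sum of a monotone and a strictly monotone operator: pair
the difference of the two equations with u - v. *)
Lemma energy_critical_unique (R : realType) (K : finType) (Q : K -> K -> R)
    (m b u v : K -> R) :
  (forall z, 0 <= bilin Q z z) -> (forall k, 0 < m k) ->
  (forall k, \sum_l Q k l * u l + m k * expR (u k) = b k) ->
  (forall k, \sum_l Q k l * v l + m k * expR (v k) = b k) ->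
  u = v.
Proof.
move=> Q_psd m_gt0 Eu Ev; pose z k := u k - v k.
have term_ge0 k : 0 <= m k * ((expR (u k) - expR (v k)) * z k).
  apply: mulr_ge0; first exact: ltW.
  rewrite /z; have [uv|vu] := leP (u k) (v k).
    by rewrite mulr_le0// subr_le0// ler_expR.
  by rewrite mulr_ge0// subr_ge0 ?ler_expR ltW.
have sum0 : bilin Q z z + \sum_k m k * ((expR (u k) - expR (v k)) * z k) = 0.
  rewrite /bilin -big_split /=; apply: big1 => k _.
  have -> : \sum_l Q k l * (z k * z l)
          = z k * (\sum_l Q k l * u l - \sum_l Q k l * v l).
    rewrite -sumrB mulr_sumr; apply: eq_bigr => l _; rewrite /z; ring.
  have -> : \sum_l Q k l * u l - \sum_l Q k l * v l
          = m k * expR (v k) - m k * expR (u k).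
    by have := Eu k; have := Ev k; lra.
  ring.
have /eqP := sum0; rewrite paddr_eq0//; last exact: sumr_ge0.
case/andP=> _; rewrite psumr_eq0// => /allP h; apply/funext => k; apply/eqP.
have := h k (mem_index_enum _); rewrite /= !mulf_eq0 (gt_eqF (m_gt0 k)) /=.
by rewrite !subr_eq0 (inj_eq (@expR_inj R)) orbb.
Qed.

(** * The coupling matrix and its inverse *)

Section Coupling.
Context {R : realType} {N : nat}.
Variables (e g : R).
Hypothesis N_gt0 : (0 < N)%N.
Hypothesis e_neq0 : e != 0.
Hypothesis g_neq0 : g != 0.

Definition coupling_inv (i j : 'I_N) : R :=
  N%:R^-1 * (2 / e ^+ 2 - 2 * N%:R / g ^+ 2) + (i == j)%:R * (2 * N%:R / g ^+ 2).

Lemma sum_const_diag (a c : R) (x : 'I_N -> R) (i : 'I_N) :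
  \sum_j (a + (i == j)%:R * c) * x j = a * \sum_j x j + c * x i.
Proof.
rewrite (eq_bigr (fun j => a * x j + (i == j)%:R * (c * x j))); last by move=> j _; ring.
rewrite big_split /= -mulr_sumr; congr (_ + _).
rewrite (bigD1 i)//= eqxx mul1r big1 ?addr0// => j; rewrite eq_sym => /negPf ->.
by rewrite mul0r.
Qed.

Lemma sum_const_diag_total (a c : R) (x : 'I_N -> R) :
  \sum_i (a * \sum_j x j + c * x i) = (N%:R * a + c) * \sum_j x j.
Proof.
by rewrite big_split /= sumr_const card_ord -mulr_sumr -mulr_natl; ring.
Qed.

Let N_neq0 : N%:R != 0 :> R.
Proof. by rewrite pnatr_eq0 -lt0n. Qed.

(** Summing either relation over i determines the sum of the other family, the
all-ones vector being an eigenvector; the entries then follow one by one. *)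
Lemma coupling_invP (x y : 'I_N -> R) :
  (forall i, y i = \sum_j coupling e g i j * x j) <->
  (forall i, x i = \sum_j coupling_inv i j * y j).
Proof.
split=> h i.
- have total : \sum_j y j = e ^+ 2 / 2 * \sum_j x j.
    under eq_bigr do rewrite h sum_const_diag.
    by rewrite sum_const_diag_total; field.
  by rewrite sum_const_diag total h sum_const_diag; field; rewrite ?N_neq0 ?e_neq0 ?g_neq0.
- have total : \sum_j x j = 2 / e ^+ 2 * \sum_j y j.
    under eq_bigr do rewrite h sum_const_diag.
    by rewrite sum_const_diag_total; field; rewrite ?N_neq0 ?e_neq0 ?g_neq0.
  by rewrite sum_const_diag total h sum_const_diag; field; rewrite ?N_neq0 ?e_neq0 ?g_neq0.
Qed.

(** The spectral decomposition: the first term is the component of d along the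
constants, the second is the component of zero sum. *)
Lemma coupling_inv_formE (d : 'I_N -> R) :
  bilin coupling_inv d d =
  2 / (N%:R * e ^+ 2) * (\sum_i d i) ^+ 2 +
  2 * N%:R / g ^+ 2 * \sum_i (d i - N%:R^-1 * \sum_j d j) ^+ 2.
Proof.
have -> : bilin coupling_inv d d = \sum_i d i * \sum_j coupling_inv i j * d j.
  by apply: eq_bigr => i _; rewrite mulr_sumr; apply: eq_bigr => j _; ring.
under eq_bigr do rewrite sum_const_diag.
set S := \sum_j d j.
have -> : \sum_i (d i - N%:R^-1 * S) ^+ 2 = \sum_i d i ^+ 2 - N%:R^-1 * S ^+ 2.
  rewrite (eq_bigr (fun i => d i ^+ 2 + (- (2 * N%:R^-1 * S) * d i
    + (N%:R^-1 * S) ^+ 2))); last by move=> i _; ring.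
  rewrite !big_split /= -mulr_sumr sumr_const card_ord -mulr_natl -/S.
  by field.
rewrite (eq_bigr (fun i => N%:R^-1 * (2 / e ^+ 2 - 2 * N%:R / g ^+ 2) * S * d i
  + 2 * N%:R / g ^+ 2 * d i ^+ 2)); last by move=> i _; ring.
rewrite big_split /= -!mulr_sumr -/S.
by field; rewrite ?N_neq0 ?e_neq0 ?g_neq0.
Qed.

Let form_terms_ge0 (d : 'I_N -> R) :
  0 <= 2 / (N%:R * e ^+ 2) * (\sum_i d i) ^+ 2 /\
  0 <= 2 * N%:R / g ^+ 2 * \sum_i (d i - N%:R^-1 * \sum_j d j) ^+ 2.
Proof.
have e2 := sqr_ge0 e; have g2 := sqr_ge0 g.
split; apply: mulr_ge0.
- by apply: divr_ge0 => //; apply: mulr_ge0.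
- exact: sqr_ge0.
- by apply: divr_ge0 => //; apply: mulr_ge0.
- by apply: sumr_ge0 => i _; exact: sqr_ge0.
Qed.

Lemma coupling_inv_ge0 (d : 'I_N -> R) : 0 <= bilin coupling_inv d d.
Proof. by rewrite coupling_inv_formE; case: (form_terms_ge0 d) => *; exact: addr_ge0. Qed.

Lemma coupling_inv_eq0 (d : 'I_N -> R) :
  bilin coupling_inv d d = 0 -> forall i, d i = 0.
Proof.
have [s1 s2] := form_terms_ge0 d.
have c1 : 2 / (N%:R * e ^+ 2) != 0.
  apply: mulf_neq0; first by rewrite pnatr_eq0.
  by rewrite invr_eq0 mulf_neq0// expf_neq0.
have c2 : 2 * N%:R / g ^+ 2 != 0.
  apply: mulf_neq0; last by rewrite invr_eq0 expf_neq0.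
  by apply: mulf_neq0 => //; rewrite pnatr_eq0.
rewrite coupling_inv_formE => /eqP; rewrite paddr_eq0// => /andP[].
rewrite mulf_eq0 (negPf c1) /= sqrf_eq0 => /eqP ->.
rewrite mulf_eq0 (negPf c2) /=.
rewrite mulr0 psumr_eq0; last by move=> i _; exact: sqr_ge0.
move=> /allP h i; have := h i (mem_index_enum _).
by rewrite /= subr0 sqrf_eq0 => /eqP.
Qed.

End Coupling.

(** * The vortex system on a weighted graph *)

Section Vortices.
Context {R : realType} {V : finType} (adj : rel V).
Hypothesis adj_conn : connected_graph adj.
Variable mu : V -> R.
Hypothesis mu_gt0 : forall x : V, 0 < mu x.
Variable w : V -> V -> R.
Hypothesis w_weight : edge_weight adj w.

(** Degree matrix minus weight matrix; weights w x x on loops cancel in its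
action. *)
Definition laplacian_matrix (x y : V) : R := (x == y)%:R * \sum_z w x z - w x y.

Lemma laplacian_matrixE (f : V -> R) (x : V) :
  \sum_y laplacian_matrix x y * f y = \sum_y w x y * (f x - f y).
Proof.
rewrite /laplacian_matrix; set D := \sum_z w x z.
rewrite (eq_bigr (fun y => (x == y)%:R * (D * f y) - w x y * f y));
  last by move=> y _; ring.
rewrite sumrB (bigD1 x)//= eqxx mul1r big1 ?addr0; last first.
  by move=> y; rewrite eq_sym => /negPf ->; rewrite mul0r.
by rewrite mulr_suml -sumrB; apply: eq_bigr => y _; ring.
Qed.

Lemma laplacian_matrix_sym (x y : V) : laplacian_matrix x y = laplacian_matrix y x.
Proof.
case: w_weight => _ w_sym _; rewrite /laplacian_matrix w_sym.
by case: eqVneq => [->|] //; rewrite ?eqxx//; rewrite !mul0r.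
Qed.

Lemma laplacianE (f : V -> R) (x : V) :
  mu x * laplacian adj mu w f x = - \sum_y laplacian_matrix x y * f y.
Proof.
case: w_weight => w_ge0 w_sym w_adj.
rewrite laplacian_matrixE /laplacian mulrA divff ?gt_eqF// mul1r -sumrN.
rewrite big_mkcond; apply: eq_bigr => y _; case: ifPn => [_|nadj].
  by rewrite w_sym; ring.
have -> : w x y = 0.
  apply/eqP; rewrite eq_le w_ge0 andbT leNgt.
  by apply: contra nadj => /w_adj.
by rewrite mul0r oppr0.
Qed.

Lemma sum_laplacian_matrix (f : V -> R) :
  \sum_x \sum_y laplacian_matrix x y * f y = 0.
Proof.
case: w_weight => _ w_sym _.
under eq_bigr do rewrite laplacian_matrixE.
under eq_bigr do (under eq_bigr do rewrite mulrBr; rewrite sumrB).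
rewrite sumrB [X in _ - X]exchange_big /= -sumrB; apply: big1 => x _.
by rewrite -sumrB; apply: big1 => y _; rewrite w_sym subrr.
Qed.

(** Summation by parts on the graph. *)
Lemma dirichlet_form (f h : V -> R) :
  bilin laplacian_matrix f h =
  2^-1 * \sum_x \sum_y w x y * ((f x - f y) * (h x - h y)).
Proof.
case: w_weight => _ w_sym _.
have -> : bilin laplacian_matrix f h = \sum_x \sum_y w x y * (f x * (h x - h y)).
  apply: eq_bigr => x _.
  have -> : \sum_y laplacian_matrix x y * (f x * h y)
          = f x * \sum_y laplacian_matrix x y * h y.
    by rewrite mulr_sumr; apply: eq_bigr => y _; ring.
  by rewrite laplacian_matrixE mulr_sumr; apply: eq_bigr => y _; ring.
set S := LHS.
have S' : S = \sum_x \sum_y w x y * (f y * (h y - h x)).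
  by rewrite exchange_big; apply: eq_bigr => x _; apply: eq_bigr => y _; rewrite w_sym.
suff : \sum_x \sum_y w x y * ((f x - f y) * (h x - h y)) = S + S by lra.
rewrite [X in _ = _ + X]S' -big_split; apply: eq_bigr => x _.
by rewrite -big_split; apply: eq_bigr => y _ /=; ring.
Qed.

Variable N : nat.
Hypothesis N_gt0 : (0 < N)%N.
Variables e g : R.
Hypothesis e_neq0 : e != 0.
Hypothesis g_neq0 : g != 0.

Definition vortex_matrix (k l : 'I_N * V) : R :=
  coupling_inv e g k.1 l.1 * laplacian_matrix k.2 l.2.

Lemma sum_pair (F : 'I_N * V -> R) : \sum_k F k = \sum_i \sum_x F (i, x).
Proof. by rewrite pair_bigA; apply: eq_bigr => -[]. Qed.

Lemma vortex_matrix_sym k l : vortex_matrix k l = vortex_matrix l k.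
Proof. by rewrite /vortex_matrix laplacian_matrix_sym /coupling_inv eq_sym. Qed.

Lemma vortex_matrixE (u : 'I_N * V -> R) (i : 'I_N) (x : V) :
  \sum_l vortex_matrix (i, x) l * u l =
  \sum_j coupling_inv e g i j * \sum_y laplacian_matrix x y * u (j, y).
Proof.
rewrite sum_pair; apply: eq_bigr => j _; rewrite mulr_sumr.
by apply: eq_bigr => y _; rewrite /vortex_matrix /= mulrA.
Qed.

Lemma vortex_formE (z : 'I_N * V -> R) :
  bilin vortex_matrix z z = 2^-1 * \sum_x \sum_y
    w x y * bilin (coupling_inv e g) (fun i => z (i, x) - z (i, y))
                                     (fun i => z (i, x) - z (i, y)).
Proof.
have -> : bilin vortex_matrix z z = \sum_i \sum_j coupling_inv e g i j *
    bilin laplacian_matrix (fun x => z (i, x)) (fun y => z (j, y)).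
  rewrite /bilin sum_pair; apply: eq_bigr => i _.
  under eq_bigr do rewrite sum_pair.
  rewrite exchange_big; apply: eq_bigr => j _; rewrite mulr_sumr.
  apply: eq_bigr => x _; rewrite mulr_sumr; apply: eq_bigr => y _.
  by rewrite /vortex_matrix /= -mulrA.
under eq_bigr do under eq_bigr do rewrite dirichlet_form mulrCA.
under eq_bigr do rewrite -mulr_sumr.
rewrite -mulr_sumr; congr (_ * _).
under eq_bigr do under eq_bigr do rewrite mulr_sumr.
under eq_bigr do rewrite exchange_big.
rewrite exchange_big; apply: eq_bigr => x _.
under eq_bigr do under eq_bigr do rewrite mulr_sumr.
under eq_bigr do rewrite exchange_big.
rewrite exchange_big; apply: eq_bigr => y _.
rewrite /bilin mulr_sumr; apply: eq_bigr => i _; rewrite mulr_sumr.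
by apply: eq_bigr => j _; ring.
Qed.

Let vortex_term_ge0 (z : 'I_N * V -> R) x y :
  0 <= w x y * bilin (coupling_inv e g) (fun i => z (i, x) - z (i, y))
                                     (fun i => z (i, x) - z (i, y)).
Proof. by case: w_weight => w_ge0 _ _; rewrite mulr_ge0// coupling_inv_ge0. Qed.

Lemma vortex_form_ge0 (z : 'I_N * V -> R) : 0 <= bilin vortex_matrix z z.
Proof.
rewrite vortex_formE mulr_ge0 ?invr_ge0//.
by apply: sumr_ge0 => x _; apply: sumr_ge0 => y _.
Qed.

(** Each edge contributes a multiple of a definite form of the increments, so z i
does not vary along edges, hence along paths. *)
Lemma vortex_form_eq0 (z : 'I_N * V -> R) : bilin vortex_matrix z z = 0 ->
  forall i x y, z (i, x) = z (i, y).
Proof.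
case: (w_weight) => _ _ w_adj.
rewrite vortex_formE => /eqP; rewrite mulf_eq0 invr_eq0 pnatr_eq0 /=.
rewrite psumr_eq0; last by move=> x _; apply: sumr_ge0 => y _.
move=> /allP h.
have edge i x y : adj x y -> z (i, x) = z (i, y).
  move=> /w_adj wxy; have := h x (mem_index_enum _).
  rewrite /= psumr_eq0// => /allP/(_ y (mem_index_enum _)) /=.
  rewrite mulf_eq0 (gt_eqF wxy) /= => /eqP /coupling_inv_eq0 d0.
  by apply/eqP; rewrite -subr_eq0; apply/eqP/d0.
move=> i x y; have /connectP[q + ->] := adj_conn x y.
elim: q x => [//|x' q IH] x /= /andP[/edge -> /IH]; exact.
Qed.

Variables (n : 'I_N -> nat) (theta : R) (p : forall i : 'I_N, 'I_(n i) -> V).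

Definition vortex_density (i : 'I_N) (x : V) : R := \sum_(s < n i) vertex_dirac mu (p s) x.

Definition vortex_source (k : 'I_N * V) : R :=
  mu k.2 * (theta ^+ 2 - 4 * pi * \sum_j coupling_inv e g k.1 j * vortex_density j k.2).

(** The integral that the equations impose on the exponential of the i-th
unknown. *)
Definition vortex_flux (i : 'I_N) : R := theta ^+ 2 * volume mu
  - 4 * pi * \sum_j coupling_inv e g i j * (n j)%:R.

Lemma integral_vortex_density (i : 'I_N) : \sum_x mu x * vortex_density i x = (n i)%:R.
Proof.
under eq_bigr do rewrite mulr_sumr.
rewrite exchange_big /= -[RHS](_ : \sum_(s < n i) 1 = _); last first.
  by rewrite sumr_const card_ord.
apply: eq_bigr => s _; rewrite (bigD1 (p s))//= /vertex_dirac eqxx.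
rewrite divff ?gt_eqF// big1 ?addr0// => x /negPf ->; exact: mulr0.
Qed.

Lemma sum_vortex_source (i : 'I_N) : \sum_x vortex_source (i, x) = vortex_flux i.
Proof.
rewrite /vortex_flux /volume [theta ^+ 2 * _]mulr_sumr.
have -> : \sum_j coupling_inv e g i j * (n j)%:R =
    \sum_x mu x * \sum_j coupling_inv e g i j * vortex_density j x.
  under eq_bigr do rewrite -integral_vortex_density mulr_sumr.
  rewrite exchange_big; apply: eq_bigr => x _; rewrite mulr_sumr.
  by apply: eq_bigr => j _; ring.
rewrite mulr_sumr -sumrB; apply: eq_bigr => x _; rewrite /vortex_source /=; ring.
Qed.

(** Apply the inverse coupling matrix to the values at each vertex, then
multiply by mu: this makes the system variational. *)
Lemma vortex_solutionP (u : 'I_N -> V -> R) :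
  vortex_solution adj mu w theta e g p u <->
  forall k, \sum_l vortex_matrix k l * u l.1 l.2 + mu k.2 * expR (u k.1 k.2)
            = vortex_source k.
Proof.
have -> : vortex_solution adj mu w theta e g p u <-> forall x i,
    laplacian adj mu w (u i) x - 4 * pi * vortex_density i x =
    \sum_j coupling e g i j * (expR (u j x) - theta ^+ 2).
  split=> h.
    by move=> x i; rewrite h addrK.
  by move=> i x; rewrite -h subrK.
have -> : (forall x i, laplacian adj mu w (u i) x - 4 * pi * vortex_density i x =
    \sum_j coupling e g i j * (expR (u j x) - theta ^+ 2)) <->
  forall x i, expR (u i x) - theta ^+ 2 = \sum_j coupling_inv e g i j *
    (laplacian adj mu w (u j) x - 4 * pi * vortex_density j x).
  by split=> h x; apply/coupling_invP.
have key x i : \sum_l vortex_matrix (i, x) l * u l.1 l.2 + mu x * expR (u i x)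
    - vortex_source (i, x) = mu x * (expR (u i x) - theta ^+ 2
    - \sum_j coupling_inv e g i j *
        (laplacian adj mu w (u j) x - 4 * pi * vortex_density j x)).
  rewrite vortex_matrixE /vortex_source /=.
  have -> : \sum_j coupling_inv e g i j * (\sum_y laplacian_matrix x y * u j y) =
      - (mu x * \sum_j coupling_inv e g i j * laplacian adj mu w (u j) x).
    rewrite mulr_sumr -sumrN; apply: eq_bigr => j _.
    by rewrite -[X in _ * X = _]opprK -laplacianE; ring.
  have -> : \sum_j coupling_inv e g i j *
        (laplacian adj mu w (u j) x - 4 * pi * vortex_density j x) =
      \sum_j coupling_inv e g i j * laplacian adj mu w (u j) x
      - 4 * pi * \sum_j coupling_inv e g i j * vortex_density j x.
    by rewrite mulr_sumr -sumrB; apply: eq_bigr => j _; ring.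
  ring.
split=> [h [i x]|h x i]; apply/eqP; rewrite -subr_eq0.
  by rewrite key h subrr mulr0.
by have := key x i; rewrite h subrr => /esym/eqP; rewrite mulf_eq0 gt_eqF.
Qed.

(** The stated bound is the flux condition multiplied by g^2 / (8 pi N). *)
Lemma vortex_flux_gt0 (i : 'I_N) : (0 < vortex_flux i) =
  ((n i)%:R < g ^+ 2 * theta ^+ 2 / (8 * pi * N%:R) * volume mu
       + N%:R^-1 * (1 - N%:R^-1 * (g / e) ^+ 2) * (\sum_(k < N) n k)%:R).
Proof.
have pi0 := pi_gt0 R.
have N0 : 0 < N%:R :> R by rewrite ltr0n.
have g2 : 0 < g ^+ 2 by rewrite exprn_even_gt0.
have c0 : 0 < g ^+ 2 / (8 * pi * N%:R) by rewrite divr_gt0// !mulr_gt0.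
rewrite -(pmulr_rgt0 _ c0) -[RHS]subr_gt0; congr (0 < _).
rewrite /vortex_flux sum_const_diag natr_sum.
(* The identity holds for any nonzero constant in place of pi. *)
move: (@pi R) pi0 {c0} => c c0; field.
by rewrite g_neq0 e_neq0 !gt_eqF.
Qed.

(** Summed over x, the Laplacian terms cancel; what remains on the left is the
integral of a positive function. *)
Lemma vortex_flux_of_solution (u : 'I_N -> V -> R) (x0 : V) :
  vortex_solution adj mu w theta e g p u -> forall i, 0 < vortex_flux i.
Proof.
move=> /vortex_solutionP h i; rewrite -sum_vortex_source.
under eq_bigr do rewrite -h vortex_matrixE.
rewrite big_split /= exchange_big /= big1 ?add0r => [|j _]; last first.
  by rewrite -mulr_sumr sum_laplacian_matrix mulr0.
rewrite (bigD1 x0)//= ltr_wpDr ?mulr_gt0 ?expR_gt0//.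
by apply: sumr_ge0 => x _; rewrite mulr_ge0 ?expR_ge0 ?ltW.
Qed.

(** On the kernel z is a family of constants c_i, so that the sum is that of
the products flux_i c_i, with c <= 0 and c <> 0. *)
Lemma vortex_recession (z : 'I_N * V -> R) : (forall i, 0 < vortex_flux i) ->
  bilin vortex_matrix z z = 0 -> (forall k, z k <= 0) -> (exists k, z k != 0) ->
  \sum_k vortex_source k * z k < 0.
Proof.
move=> flux_gt0 /vortex_form_eq0 zc z_le0 [[i0 x0] z0].
rewrite sum_pair (eq_bigr (fun i => vortex_flux i * z (i, x0))); last first.
  move=> i _; rewrite -sum_vortex_source mulr_suml; apply: eq_bigr => x _.
  by rewrite (zc i x x0).
rewrite (bigD1 i0)//= -oppr_gt0 opprD ltr_wpDr//.
  rewrite oppr_ge0; apply: sumr_le0 => i _.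
  by apply: mulr_ge0_le0; [exact: ltW|exact: z_le0].
by rewrite oppr_gt0 pmulr_rlt0// lt_neqAle z0 z_le0.
Qed.

Lemma vortex_solution_exists : (forall i, 0 < vortex_flux i) ->
  exists u, vortex_solution adj mu w theta e g p u.
Proof.
move=> flux_gt0.
have [u hu] := energy_critical_point vortex_form_ge0 (fun k => mu_gt0 k.2)
  (fun z => vortex_recession flux_gt0) vortex_matrix_sym.
exists (fun i x => u (i, x)); apply/vortex_solutionP => -[i x].
rewrite -hu; congr (_ + _).
by apply: eq_bigr => -[j y] _.
Qed.

Lemma vortex_solution_unique (u v : 'I_N -> V -> R) :
  vortex_solution adj mu w theta e g p u -> vortex_solution adj mu w theta e g p v ->
  u = v.
Proof.
move=> /vortex_solutionP hu /vortex_solutionP hv.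
have uv := energy_critical_unique vortex_form_ge0 (fun k => mu_gt0 k.2) hu hv.
by apply/funext => i; apply/funext => x; have := congr1 (fun f => f (i, x)) uv.
Qed.

End Vortices.

Theorem theorem2p2 (R : realType) (V : finType) (adj : rel V)
    (adj_sym : symmetric adj) (adj_conn : connected_graph adj)
    (mu : V -> R) (mu_gt0 : forall x : V, 0 < mu x)
    (w : V -> V -> R) (w_weight : edge_weight adj w)
    (N : nat) (N_gt0 : (0 < N)%N)
    (n : 'I_N -> nat) (n_gt0 : forall i : 'I_N, (0 < n i)%N)
    (theta e g : R) (e_neq0 : e != 0) (g_neq0 : g != 0)
    (p : forall i : 'I_N, 'I_(n i) -> V) :
  (exists! u : 'I_N -> V -> R, vortex_solution adj mu w theta e g p u) <->
  (forall i : 'I_N,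
     (n i)%:R < g ^+ 2 * theta ^+ 2 / (8 * pi * N%:R) * volume mu
       + N%:R^-1 * (1 - N%:R^-1 * (g / e) ^+ 2) * (\sum_(k < N) n k)%:R).
Proof.
split=> [[u [hu _]] i|bound].
  have x0 : V := p i (Ordinal (n_gt0 i)).
  rewrite -vortex_flux_gt0//.
  exact: (vortex_flux_of_solution mu_gt0 w_weight N_gt0 e_neq0 g_neq0 x0 hu).
have flux_gt0 i : 0 < vortex_flux mu e g n theta i by rewrite vortex_flux_gt0.
have [u hu] :=
  vortex_solution_exists adj_conn mu_gt0 w_weight N_gt0 e_neq0 g_neq0 p flux_gt0.
exists u; split=> // v.
exact: (vortex_solution_unique mu_gt0 w_weight N_gt0 e_neq0 g_neq0 hu).
Qed.
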